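(* Let $T$ be a tree on $n$ vertices (agents) rooted at $r$, with valuations $(f_v)_{v\in T}$. The TreeCore protocol described below returns a partial allocation that is locally envy-free on $T$ (every agent $v$ satisfies $f_v(A_v)\ge f_v(A_u)$ for every neighbor $u$ of $v$ in $T$), and it uses at most $2n^2$ queries. Moreover, no agent envies any of her descendants in $T$ (i.e. $f_v(A_v)\ge f_v(A_w)$ for every descendant $w$ of $v$), and the root $r$ obtains a piece of value exactly $1/n$ to her, $f_r(A_r)=1/n$.
   Context: Cake $[0,1]$; pieces are finite unions of subintervals; valuations $f_v$ are nonnegative, normalized ($f_v([0,1])=1$), additive and divisible. Queries are Robertson–Webb evaluation queries (return $f_v([x,y])$) and cut queries (given $x,\alpha,v$ return $y$ with $f_v([x,y])=\alpha$). For a vertex $v$, $T(v)$ denotes the subtree rooted at $v$ and $|T(v)|$ its number of vertices. TreeCore protocol: (1) The root $r$ cuts $[0,1]$ into $n$ pieces of equal value to her and temporarily holds all of them; the residue $R$ is initialized to $\emptyset$. (2) For each agent $v$ in breadth-first order from $r$: at this moment $v$ holds $|T(v)|$ pieces; let $p^*$ be the one she values least; for each piece $p$ she holds, she cuts off a part of it so that the remaining part $p'$ satisfies $f_v(p')=f_v(p^* )$, and $p\setminus p'$ is added to $R$; then each child $u$ of $v$, in arbitrary order, takes the $|T(u)|$ pieces she values most among the pieces $v$ currently still holds; the one piece $v$ still holds afterwards is allocated to $v$ as $A_v$. (3) Return the allocation $\{A_v\}$ and the residue $R$. *)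

(* Defs.v *)
From HB Require Import structures.
From mathcomp Require Import all_boot all_order all_algebra.
From mathcomp Require Import boolp classical_sets set_interval reals.

Set Implicit Arguments.
Unset Strict Implicit.
Unset Printing Implicit Defensive.

Import Order.TTheory GRing.Theory Num.Theory.

Local Open Scope ring_scope.
Local Open Scope classical_set_scope.

Section Cake.
Variable R : realType.

Definition is_piece (P : set R) : Prop :=
  P `<=` `[0, 1] /\
  exists s : seq (interval R), P = \big[setU/set0]_(i <- s) [set` i].

(* Additivity is for pieces without a common point; together with divisibility it
   forces singletons to have value 0, so that open, closed and half-open
   intervals with the same endpoints have the same value. *)
Record is_valuation (f : set R -> R) : Prop := IsValuation {
  valuation_ge0 : forall P, is_piece P -> 0 <= f P;
  valuation_cake : f `[0, 1] = 1;
  valuation_add : forall P Q, is_piece P -> is_piece Q ->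
    P `&` Q = set0 -> f (P `|` Q) = f P + f Q;
  valuation_divisible : forall x y l,
    0 <= x -> x <= y -> y <= 1 -> 0 <= l <= 1 ->
    exists2 z, x <= z <= y & f `[x, z] = l * f `[x, y]
}.

End Cake.

Section Queries.
Variables (R : realType) (V : finType).

(* Programs that see the valuations only through the answers to their queries.
   [Choose P k] continues with an arbitrary [c] such that [P c]; it models the
   choices a protocol leaves open and costs no query. *)
Inductive prog (X : Type) : Type :=
| Ret of X
| Eval (v : V) (x y : R) (k : R -> prog X)
| Cut (v : V) (x alpha : R) (k : R -> prog X)
| Choose (C : Type) (P : C -> Prop) (k : C -> prog X).

Fixpoint bind (X Y : Type) (p : prog X) (g : X -> prog Y) : prog Y :=
  match p with
  | Ret a => g a
  | Eval v x y k => Eval v x y (fun z => bind (k z) g)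
  | Cut v x alpha k => Cut v x alpha (fun z => bind (k z) g)
  | Choose C P k => Choose P (fun c => bind (k c) g)
  end.

Variable f : V -> set R -> R.

Definition cut_answer (v : V) (x alpha y : R) : Prop :=
  [/\ 0 <= x, x <= y, y <= 1 & f v `[x, y] = alpha].

(* [run p a q]: some execution of [p] returns [a] after exactly [q] queries.
   Any valid answer to a cut query may be received. *)
Fixpoint run (X : Type) (p : prog X) (a : X) (q : nat) : Prop :=
  match p with
  | Ret b => b = a /\ q = 0%N
  | Eval v x y k =>
      [/\ 0 <= x, x <= y & y <= 1] /\
      exists2 q', q = q'.+1 & run (k (f v `[x, y])) a q'
  | Cut v x alpha k =>
      exists y, cut_answer v x alpha y /\
      exists2 q', q = q'.+1 & run (k y) a q'
  | Choose C P k => exists2 c, P c & run (k c) a q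
  end.

(* No execution of [p] ever reaches an ill-formed evaluation query, a cut query
   without a valid answer, or an impossible choice. *)
Fixpoint never_stuck (X : Type) (p : prog X) : Prop :=
  match p with
  | Ret _ => True
  | Eval v x y k =>
      [/\ 0 <= x, x <= y & y <= 1] /\ never_stuck (k (f v `[x, y]))
  | Cut v x alpha k =>
      (exists y, cut_answer v x alpha y) /\
      forall y, cut_answer v x alpha y -> never_stuck (k y)
  | Choose C P k =>
      (exists c, P c) /\ forall c, P c -> never_stuck (k c)
  end.

End Queries.

Arguments Ret {R V X}.
Arguments Eval {R V X}.
Arguments Cut {R V X}.
Arguments Choose {R V X C}.

Notation "x <-- p ;; q" := (bind p (fun x => q))
  (at level 65, p at next level, right associativity).

Section RootedTree.
Variables (V : finType) (e : rel V) (r : V).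

Definition is_tree : Prop :=
  [/\ symmetric e, irreflexive e, forall x y, connect e x y
    & forall c, ucycle e c -> (size c <= 2)%N].

(* w is in T(v) when the path from r to w goes through v. *)
Definition subtree (v : V) : pred V := fun w =>
  `[< exists p, [/\ path e r p, uniq (r :: p), last r p = w & v \in r :: p] >].

Definition children (v : V) : pred V := fun u => e v u && (u \in subtree v).

(* [bfs_from queue s]: breadth-first search started with this queue visits the
   vertices in the order [s]. *)
Inductive bfs_from : seq V -> seq V -> Prop :=
| bfs_nil : bfs_from [::] [::]
| bfs_cons v queue us s :
    perm_eq us (enum (children v)) ->
    bfs_from (queue ++ us) s -> bfs_from (v :: queue) (v :: s).

Definition bfs_order (s : seq V) : Prop := bfs_from [:: r] s.

End RootedTree.

Section TreeCore.
Variables (R : realType) (V : finType) (e : rel V) (r : V).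

(* The pieces handled by the protocol are intervals [0, y] or ]x, y], so that
   each cut point belongs to exactly one piece. Endpoints have value 0: such a
   piece is evaluated by the query on [x, y]. *)
Definition endpoint (b : itv_bound R) : R := if b is BSide _ x then x else 0.

Record state := State {
  held : V -> seq (interval R);
  alloc : V -> set R;
  residue : set R
}.

Fixpoint cut_equal (v : V) (alpha : R) (k : nat) (lb : itv_bound R) :
    prog R V (seq (interval R)) :=
  if k is k'.+1 then
    y <-- Cut v (endpoint lb) alpha Ret ;;
    ps <-- cut_equal v alpha k' (BRight y) ;;
    Ret (Interval lb (BRight y) :: ps)
  else Ret [:: Interval lb (BRight 1)].

Fixpoint eval_all (v : V) (ps : seq (interval R)) :
    prog R V (seq (interval R * R)) :=
  if ps is p :: ps' then
    let: Interval lb rb := p in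
    a <-- Eval v (endpoint lb) (endpoint rb) Ret ;;
    vs <-- eval_all v ps' ;;
    Ret ((p, a) :: vs)
  else Ret [::].

Definition least_valued (vs : seq (interval R * R)) (c : interval R * R) :=
  c \in vs /\ forall d, d \in vs -> c.2 <= d.2.

(* Trims every piece down to value alpha, returning the remaining parts and
   the union of the parts cut off. *)
Fixpoint trim_all (v : V) (alpha : R) (vs : seq (interval R * R)) :
    prog R V (seq (interval R) * set R) :=
  if vs is (p, a) :: vs' then
    let: Interval lb rb := p in
    p' <-- (if a == alpha then Ret p
            else y <-- Cut v (endpoint lb) alpha Ret ;;
                 Ret (Interval lb (BRight y))) ;;
    t <-- trim_all v alpha vs' ;;
    Ret (p' :: t.1, ([set` p] `\` [set` p']) `|` t.2)
  else Ret ([::], set0).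

(* [c.1] consists of [m] most valued pieces of [vs] and [c.2] of the others. *)
Definition most_valued (m : nat) (vs : seq (interval R * R))
    (c : seq (interval R * R) * seq (interval R * R)) :=
  [/\ perm_eq (c.1 ++ c.2) vs, size c.1 = m
    & forall t s, t \in c.1 -> s \in c.2 -> s.2 <= t.2].

(* The agents [us] successively take pieces out of [ps]. *)
Fixpoint serve (us : seq V) (ps : seq (interval R))
    (h : V -> seq (interval R)) :
    prog R V (seq (interval R) * (V -> seq (interval R))) :=
  if us is u :: us' then
    vs <-- eval_all u ps ;;
    c <-- Choose (most_valued #|subtree e r u| vs) Ret ;;
    serve us' (unzip1 c.2) [eta h with u |-> unzip1 c.1]
  else Ret (ps, h).

Definition agent_step (v : V) (st : state) : prog R V state :=
  vs <-- eval_all v (held st v) ;;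
  c <-- Choose (least_valued vs) Ret ;;
  t <-- trim_all v c.2 vs ;;
  us <-- Choose (fun us => perm_eq us (enum (children e r v))) Ret ;;
  w <-- serve us t.1 (held st) ;;
  p <-- Choose (fun p => w.1 = [:: p]) Ret ;;
  Ret (State [eta w.2 with v |-> [:: p]]
             [eta alloc st with v |-> [set` p]]
             (residue st `|` t.2)).

Fixpoint agent_steps (s : seq V) (st : state) : prog R V state :=
  if s is v :: s' then
    st' <-- agent_step v st ;; agent_steps s' st'
  else Ret st.

Definition TreeCore : prog R V ((V -> set R) * set R) :=
  ps <-- cut_equal r (#|V|%:R^-1) #|V|.-1 (BLeft 0) ;;
  s <-- Choose (bfs_order e r) Ret ;;
  st <-- agent_steps s (State [eta (fun=> [::]) with r |-> ps]
                              (fun=> set0) set0) ;;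
  Ret (alloc st, residue st).

End TreeCore.

Section Fairness.
Variables (R : realType) (V : finType).

Definition partial_allocation (A : V -> set R) (Res : set R) : Prop :=
  [/\ forall v, is_piece (A v), is_piece Res,
      forall u v, u != v -> A u `&` A v = set0,
      forall v, A v `&` Res = set0
    & \bigcup_v A v `|` Res = `[0, 1]].

Definition locally_envy_free (e : rel V) (f : V -> set R -> R)
    (A : V -> set R) : Prop :=
  forall v u, e v u -> f v (A u) <= f v (A v).

End Fairness.

(* Main.v *)
Require Import Defs.
From mathcomp Require Import all_boot all_order all_algebra.
From mathcomp Require Import boolp classical_sets set_interval reals.
From mathcomp Require Import zify.

(** When [v] acts, she equalizes the pieces she holds, so she values all of them
    exactly as much as the piece she keeps; her descendants end up with subsets
    of these pieces, hence she envies none of them. A child [u] picks her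
    favourite pieces before her parent [v] is left with [A_v], so each of them
    is worth at least [A_v] to [u], and trimming never goes below the least of
    them. The root starts from pieces of value [1/n] and trims nothing. These
    facts are carried by one invariant along the breadth-first search, where
    both "the processed vertices and the subtrees of the queue partition the
    tree" and "the held pieces and the residue partition the cake" are stated as
    pointwise identities between sums of 0/1 indicators. Queries are counted by
    an amortized charge, quadratic in the size of a subtree. *)

Set Implicit Arguments.
Unset Strict Implicit.
Unset Printing Implicit Defensive.

Import Order.TTheory GRing.Theory Num.Theory.

(** * Specifications for query programs: safety together with a bound on results and query counts *)

Section ProgramLogic.
Variables (R : realType) (V : finType) (f : V -> set R -> R).

(** Safety and partial correctness are paired so that one pass over a protocol proves both. The
    postcondition also sees the query count, and each rule for a query shifts it by one. *)
Definition spec (X : Type) (p : prog R V X) (Q : X -> nat -> Prop) : Prop :=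
  never_stuck f p /\ forall a q, run f p a q -> Q a q.

Lemma spec_ret X (a : X) (Q : X -> nat -> Prop) : Q a 0 -> spec (Ret a) Q.
Proof. by move=> Qa; split=> // b q [<- ->]. Qed.

Lemma spec_eval X v x y (k : R -> prog R V X) (Q : X -> nat -> Prop) :
  [/\ 0 <= x, x <= y & y <= 1]%R ->
  spec (k (f v `[x, y]%classic)) (fun a q => Q a q.+1) ->
  spec (Eval v x y k) Q.
Proof. by move=> xy [ns rn]; split=> // a q [_ [q' -> /rn]]. Qed.

Lemma spec_cut X v x alpha (k : R -> prog R V X) (Q : X -> nat -> Prop) :
  (exists y, cut_answer f v x alpha y) ->
  (forall y, cut_answer f v x alpha y -> spec (k y) (fun a q => Q a q.+1)) ->
  spec (Cut v x alpha k) Q.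
Proof.
move=> ex sk; split=> [|a q [y [Hy [q' -> rn]]]].
  by split=> // y /sk [].
by have [_] := sk y Hy; apply.
Qed.

Lemma spec_choose X C (P : C -> Prop) (k : C -> prog R V X)
    (Q : X -> nat -> Prop) :
  (exists c, P c) -> (forall c, P c -> spec (k c) Q) -> spec (Choose P k) Q.
Proof.
move=> ex sk; split=> [|a q [c Pc rn]]; first by split=> // c /sk [].
by have [_] := sk c Pc; apply.
Qed.

Lemma spec_weaken X (p : prog R V X) (Q Q' : X -> nat -> Prop) :
  spec p Q -> (forall a q, Q a q -> Q' a q) -> spec p Q'.
Proof. by case=> ns rn QQ'; split=> // a q /rn/QQ'. Qed.

Lemma run_bind X Y (p : prog R V X) (g : X -> prog R V Y) b q :
  run f (bind p g) b q ->
  exists a q1 q2, [/\ run f p a q1, run f (g a) b q2 & q = q1 + q2].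
Proof.
elim: p q => [a|v x y k IH|v x al k IH|C P k IH] q /=.
- by move=> rn; exists a, 0, q.
- case=> xy [q' -> /IH [a [q1 [q2 [r1 r2 ->]]]]].
  by exists a, q1.+1, q2; split=> //; split=> //; exists q1.
- case=> y [Hy [q' -> /IH [a [q1 [q2 [r1 r2 ->]]]]]].
  by exists a, q1.+1, q2; split=> //; exists y; split=> //; exists q1.
- case=> c Pc /IH [a [q1 [q2 [r1 r2 ->]]]].
  by exists a, q1, q2; split=> //; exists c.
Qed.

(** The continuation has to be safe only on results that [p] can actually return; this is what lets
    facts proved about [p] justify the queries made after it. *)
Lemma never_stuck_bind X Y (p : prog R V X) (g : X -> prog R V Y) :
  never_stuck f p -> (forall a q, run f p a q -> never_stuck f (g a)) ->
  never_stuck f (bind p g).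
Proof.
elim: p => [a|v x y k IH|v x al k IH|C P k IH] /=.
- by move=> _ /(_ a 0); apply.
- case=> xy ns ng; split=> //; apply: IH => // a q rn.
  by apply: (ng a q.+1); split=> //; exists q.
- case=> ex ns ng; split=> // y Hy; apply: IH => [|a q rn]; first exact: ns.
  by apply: (ng a q.+1); exists y; split=> //; exists q.
- case=> ex ns ng; split=> // c Pc; apply: IH => [|a q rn]; first exact: ns.
  by apply: (ng a q); exists c.
Qed.

Lemma spec_bind X Y (p : prog R V X) (g : X -> prog R V Y)
    (Q : X -> nat -> Prop) (Q' : Y -> nat -> Prop) :
  spec p Q ->
  (forall a q1, Q a q1 -> spec (g a) (fun b q2 => Q' b (q1 + q2))) ->
  spec (bind p g) Q'.
Proof.
case=> ns rn H; split.
  by apply: never_stuck_bind => // a q /rn/H [].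
move=> b q rb; have [a [q1 [q2 [ra {}rb ->]]]] := run_bind rb.
by have [_] := H _ _ (rn _ _ ra); apply.
Qed.

End ProgramLogic.

(** * Rooted trees: unique root paths, children, and the recursion on subtrees *)

Section RootedTreeFacts.
Variables (V : finType) (e : rel V) (r : V).
Hypothesis He : is_tree e.

(** Common first steps are peeled off by induction. Two paths that diverge must meet again, at the
    latest at their common end, and the two branches then enclose a cycle that a tree forbids. *)
Lemma simple_path_unique x p q :
  path e x p -> path e x q -> uniq (x :: p) -> uniq (x :: q) ->
  last x p = last x q -> p = q.
Proof.
have [sym _ _ acyc] := He.
elim: p x q => [|a p IH] x [|b q] //=.
- by move=> _ _ _ /andP[+ _] xq; rewrite xq mem_last.
- by move=> _ _ /andP[+ _] _ xp; rewrite -xp mem_last.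
move=> /andP[xa ap] /andP[xb bq] /andP[xNp up] /andP[xNq uq] lpq.
have [ab|ab] := eqVneq a b.
  by rewrite -ab in bq uq lpq *; congr cons; apply: IH lpq.
have /split_find E : has (mem (b :: q)) (a :: p).
  by apply/hasP; exists (last a p); rewrite ?mem_last //= lpq mem_last.
have pathp : path e x (a :: p) by rewrite /= xa.
have pathq : path e x (b :: q) by rewrite /= xb.
have ap0 : uniq (a :: p) by [].
have bq0 : uniq (b :: q) by [].
move: xNp xNq ab pathp pathq ap0 bq0 {up uq xa xb ap bq lpq IH}.
(* Stated through [head], the inequality survives the splitting of both sequences at their meeting
   point. *)
have -> : (a != b) = (head x (a :: p) != head x (b :: q)) by [].
case: E => z p1 p2; set P := b :: q => zq p1Nq.
case/splitPr: {q b}P / zq p1Nq => q1 q2 p1Nq xNp xNq ab pp pq up uq.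
(* [z] is the first vertex where the paths meet again; closing them there
   gives a cycle, of length at least 3 because they start differently. *)
pose c := x :: p1 ++ z :: rev q1.
suff /acyc : ucycle e c.
  rewrite /c /= size_cat /= size_rev => le2; exfalso; move: ab le2.
  clear; case: p1 => [|? ?]; case: q1 => [|? ?] /=; rewrite ?eqxx //; lia.
move: pp; rewrite cat_path rcons_path => /andP[/andP[pp1 pz] _].
move: pq; rewrite cat_path /= => /and3P[pq1 qz _].
apply/andP; split.
  rewrite /c /= rcons_cat cat_path pp1 /= pz /=.
  have -> : rcons (rev q1) x = rev (x :: q1) by rewrite rev_cons.
  have := rev_path e x (rcons q1 z); rewrite last_rcons belast_rcons.
  under [in RHS]eq_path => ? ? do rewrite sym.
  by rewrite rcons_path pq1 qz.
move: up uq xNp xNq p1Nq.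
rewrite cat_uniq rcons_uniq => /andP[/andP[zp1 up1] _].
rewrite cat_uniq /= => /and3P[uq1]; rewrite negb_or => /andP[zq1 _] _.
rewrite !mem_cat mem_rcons !inE !negb_or => /andP[/andP[xz xp1] _].
move=> /andP[xq1 _] p1Nq.
rewrite mem_rev xz xp1 xq1 cat_uniq up1 /=.
rewrite mem_rev zq1 rev_uniq uq1 !negb_or zp1 /= andbT.
apply/hasPn => y; rewrite mem_rev => yq1.
apply: contra p1Nq => yp1; apply/hasP; exists y => //=.
by rewrite mem_cat yq1.
Qed.

Lemma ex_root_path w :
  exists p, [/\ path e r p, uniq (r :: p) & last r p = w].
Proof.
have [_ _ /(_ r w) /connectP [p ep ->] _] := He.
by have [p' ? ? _] := shortenP ep; exists p'.
Qed.

Definition root_path w : seq V := projT1 (cid (ex_root_path w)).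

Lemma root_pathP w : [/\ path e r (root_path w), uniq (r :: root_path w)
  & last r (root_path w) = w].
Proof. exact: projT2 (cid (ex_root_path w)). Qed.

Lemma last_root_path w : last r (root_path w) = w.
Proof. by case: (root_pathP w). Qed.

Lemma root_path_unique p w :
  path e r p -> uniq (r :: p) -> last r p = w -> p = root_path w.
Proof.
move=> ep up lp; have [ew uw lw] := root_pathP w.
by apply: simple_path_unique ep ew up uw _; rewrite lp lw.
Qed.

Lemma root_path_inj : injective root_path.
Proof. by move=> v w E; rewrite -(last_root_path v) E last_root_path. Qed.

(** By uniqueness of simple paths, the existential in [subtree] can only be witnessed by
    [root_path w]. *)
Lemma subtreeE v w : (w \in subtree e r v) = (v \in r :: root_path w).
Proof.
apply/asboolP/idP => [[p [ep up lp vp]]|vw].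
  by rewrite -(root_path_unique ep up lp).
by have [ew uw lw] := root_pathP w; exists (root_path w).
Qed.

Lemma root_path_split v w : v \in r :: root_path w ->
  exists p, root_path w = root_path v ++ p.
Proof.
have [ew uw _] := root_pathP w; move=> vw.
case/splitPl: vw ew uw => p1 p2 lp1; rewrite cat_path => /andP[ep1 _] uw.
exists p2; congr (_ ++ _); apply: root_path_unique => //.
by move: uw; rewrite -cat_cons cat_uniq => /andP[].
Qed.

Lemma prefix_root_path v a p w : root_path w = rcons (root_path v) a ++ p ->
  root_path a = rcons (root_path v) a.
Proof.
have [ew uw _] := root_pathP w; move=> E; rewrite E in ew uw.
apply/esym/root_path_unique; last by rewrite last_rcons.
  by move: ew; rewrite cat_path => /andP[].
by move: uw; rewrite -cat_cons cat_uniq => /andP[].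
Qed.

Lemma edge_root_path v u : e v u -> u \notin r :: root_path v ->
  root_path u = rcons (root_path v) u.
Proof.
move=> vu uNv; have [ev uv lv] := root_pathP v.
apply/esym/root_path_unique; last by rewrite last_rcons.
  by rewrite rcons_path ev lv.
by rewrite -rcons_cons rcons_uniq uNv.
Qed.

(** If [v] lies on the root path of [u], the part after [v] ends in [u], and it is nonempty because
    [e] is irreflexive. Simplicity then keeps [u] off the root path of [v], so the edge extends that
    path. Parenthood thus becomes an equation between sequences. *)
Lemma childrenE v u : children e r v u = (root_path u == rcons (root_path v) u).
Proof.
rewrite /children subtreeE; apply/andP/eqP => [[vu vpu]|E]; last first.
  split; last first.
    rewrite E -rcons_cons mem_rcons inE; apply/orP; right.
    by rewrite -[X in X \in _]last_root_path mem_last.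
  by have [] := root_pathP u; rewrite E rcons_path last_root_path => /andP[].
have [p E] := root_path_split vpu.
apply: edge_root_path => //; have [_ irr _ _] := He.
have [_ uu lu] := root_pathP u.
move: uu lu; rewrite E -cat_cons cat_uniq last_cat last_root_path.
case: p {E} => [|a p] /=; first by move=> _ uv; rewrite uv irr in vu.
move=> /and3P[_ + _] la; rewrite negb_or => /andP[aN pN].
have := mem_last a p; rewrite la inE => /predU1P[->//|/(hasPn pN)//].
Qed.

Lemma subtree_refl v : v \in subtree e r v.
Proof. by rewrite subtreeE -[X in X \in _](last_root_path v) mem_last. Qed.

Lemma subtree_root w : w \in subtree e r r.
Proof. by rewrite subtreeE mem_head. Qed.

Lemma edge_children v u : e v u -> children e r v u \/ children e r u v.
Proof.
move=> vu; have [uv|uNv] := boolP (u \in r :: root_path v); [right|left].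
  by have [sym _ _ _] := He; rewrite /children sym vu subtreeE.
by rewrite childrenE; apply/eqP/edge_root_path.
Qed.

Lemma subtree_child v v' u :
  children e r v' u -> u \in subtree e r v -> v = u \/ v' \in subtree e r v.
Proof.
rewrite childrenE !subtreeE => /eqP ->; rewrite -rcons_cons mem_rcons inE.
by case/predU1P; [left|right].
Qed.

Lemma parent_unique v v' u :
  children e r v u -> children e r v' u -> v = v'.
Proof.
rewrite !childrenE => /eqP -> /eqP /rcons_inj [E].
exact: root_path_inj.
Qed.

Lemma root_not_child v : ~~ children e r v r.
Proof.
rewrite childrenE; apply/eqP => E; have [_] := root_pathP r.
by rewrite E /= mem_rcons inE eqxx.
Qed.

Lemma child_neq v u : children e r v u -> u != v.
Proof.
move=> /andP[vu _]; apply/eqP => uv; have [_ irr _ _] := He.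
by rewrite uv irr in vu.
Qed.

(** As an equation between indicators, this says at once that [v] and the subtrees of its children
    cover the subtree of [v] and that they are disjoint. *)
Lemma subtree_rec v w : (w \in subtree e r v : nat) =
  (w == v) + \sum_(u | children e r v u) (w \in subtree e r u).
Proof.
have [vw|vNw] := boolP (w \in subtree e r v); last first.
  rewrite big1 ?addn0 => [|u vu].
    by apply/esym/eqP; rewrite eqb0; apply: contra vNw => /eqP->; exact: subtree_refl.
  apply/eqP; rewrite eqb0; apply: contra vNw; rewrite !subtreeE => uw.
  have [p ->] := root_path_split uw; move: vu; rewrite childrenE => /eqP ->.
  rewrite -cat_cons mem_cat -rcons_cons mem_rcons inE.
  by rewrite -[X in X \in _](last_root_path v) mem_last orbT.
move: (vw); rewrite subtreeE => /root_path_split [[|a p] E].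
  have -> : w = v by apply: root_path_inj; rewrite E cats0.
  rewrite eqxx big1 // => u; rewrite childrenE subtreeE => /eqP uv.
  apply/eqP; rewrite eqb0; apply/negP => /root_path_split [p].
  by rewrite uv => /(congr1 size); rewrite size_cat size_rcons; lia.
rewrite -cat_rcons in E.
(* The vertex [a] that follows [v] on the root path of [w] is the only child of [v] whose subtree
   contains [w]. *)
have va : children e r v a by rewrite childrenE (prefix_root_path E).
rewrite (bigD1 a) //= big1 => [|u /andP[vu ua]]; last first.
  apply/eqP; rewrite eqb0; apply: contra ua; rewrite subtreeE.
  move=> /root_path_split [p']; move: vu; rewrite childrenE => /eqP ->.
  rewrite E => /eqP; rewrite eqseq_cat ?size_rcons // => /andP[/eqP /rcons_inj [->] _].
  by [].
have -> : (w == v) = false.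
  apply/negP => /eqP wv; move: E; rewrite wv => /(congr1 size).
  by rewrite size_cat size_rcons; lia.
have -> : w \in subtree e r a; last by [].
by rewrite subtreeE E -cat_cons mem_cat -rcons_cons mem_rcons mem_head.
Qed.

Lemma card_subtree_rec v : #|subtree e r v| =
  (\sum_(u | children e r v u) #|subtree e r u|).+1.
Proof.
have cardE A : #|A : pred V| = \sum_w (w \in A : nat).
  by rewrite -sum1_card big_mkcond; apply: eq_bigr => w _; case: (w \in A).
rewrite cardE; under eq_bigr => w _ do rewrite subtree_rec.
rewrite big_split /= exchange_big /= (bigD1 v) //= eqxx big1 => [|w /negPf-> //].
by rewrite addn0 add1n; congr _.+1; apply: eq_bigr => u _; rewrite cardE.
Qed.

Lemma card_subtree_gt0 v : 0 < #|subtree e r v|.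
Proof. by rewrite card_subtree_rec. Qed.

Lemma card_subtree_root : #|subtree e r r| = #|V|.
Proof. by apply: eq_card => w; rewrite subtree_root. Qed.

Lemma big_children (us : seq V) v (F : V -> nat) :
  perm_eq us (enum (children e r v)) ->
  \sum_(u <- us) F u = \sum_(u | children e r v u) F u.
Proof. by move=> /(perm_big _) ->; rewrite /= big_enum. Qed.

Lemma ex_bfs_from queue : exists s, bfs_from e r queue s.
Proof.
(* The total size of the queued subtrees decreases by one at each step, since a vertex is replaced
   by its children. *)
have [m] := ubnP (\sum_(u <- queue) #|subtree e r u|).
elim: m queue => // m IH [|v queue]; first by exists [::]; constructor.
rewrite big_cons card_subtree_rec => lt.
have [|s Hs] := IH (queue ++ enum (children e r v)).
  by rewrite big_cat /= (big_children _ (perm_refl _)); lia.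
by exists (v :: s); apply: bfs_cons Hs; exact: perm_refl.
Qed.

End RootedTreeFacts.

(** * Interval pieces and the values of intervals *)

Section Pieces.
Variable R : realType.
Local Open Scope ring_scope.
Local Open Scope classical_set_scope.

Lemma is_piece_itv (i : interval R) :
  [set` i] `<=` `[0, 1] -> is_piece [set` i].
Proof. by move=> sub; split=> //; exists [:: i]; rewrite big_seq1. Qed.

Lemma is_piece0 : is_piece (set0 : set R).
Proof. by split; [exact: sub0set | exists [::]; rewrite big_nil]. Qed.

Lemma is_pieceU (P Q : set R) : is_piece P -> is_piece Q -> is_piece (P `|` Q).
Proof.
move=> [subP [s Ps]] [subQ [t Qt]]; split; first by rewrite subUset.
by exists (s ++ t); rewrite big_cat /= -Ps -Qt.
Qed.

(** These are the intervals the protocol produces: the left end is open or closed, while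
    [BSide false] on the right includes [y]. The case [x = y] is allowed, as a cut may fall on the
    left end. *)
Definition cake_itv (p : interval R) : bool :=
  if p is Interval (BSide _ x) (BSide false y) then
    [&& 0 <= x, x <= y & y <= 1]
  else false.

Lemma cake_itvP p : cake_itv p ->
  exists b x y, [/\ p = Interval (BSide b x) (BRight y), 0 <= x, x <= y & y <= 1].
Proof.
by case: p => [[b x|//] [[//|] y|//]] /= /and3P[*]; exists b, x, y.
Qed.

Lemma cake_itv_sub p : cake_itv p -> [set` p] `<=` `[0, 1].
Proof.
move=> /cake_itvP [b [x [y [-> x0 _ y1]]]] z /=; rewrite !in_itv /=.
move=> /andP[xz zy]; rewrite (le_trans zy y1) andbT (le_trans x0) //.
by case: b xz => //= /ltW.
Qed.

Lemma cake_itv_piece p : cake_itv p -> is_piece [set` p].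
Proof. by move=> /cake_itv_sub; exact: is_piece_itv. Qed.

(** The bound [BRight y] includes [y] on the right and excludes it on the left, so the cut point is
    counted exactly once. *)
Lemma mem_itv_split b (x y z t : R) : x <= y -> y <= z ->
  ((t \in Interval (BSide b x) (BRight y)) +
   (t \in Interval (BRight y) (BRight z)))%N =
  (t \in Interval (BSide b x) (BRight z)).
Proof.
move=> xy yz; rewrite !in_itv /=; have [ty|yt] /= := leP t y.
  by rewrite (le_trans ty yz) addn0.
have xt := le_lt_trans xy yt.
by have -> : (x < t ?<= if b) by case: b => //=; exact: ltW.
Qed.

Section Valuation.
Variable g : set R -> R.
Hypothesis Hg : is_valuation g.

(** Divisibility with ratio 0 on the degenerate interval leaves [x] as the only possible cut
    point. *)
Lemma valuation_pt x : 0 <= x <= 1 -> g `[x, x] = 0.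
Proof.
move=> /andP[x0 x1].
have := @valuation_divisible _ _ Hg x x 0 x0 (lexx x) x1.
rewrite lexx ler01 => /(_ isT) [z /andP[xz zx]].
have -> : z = x by apply/eqP; rewrite eq_le xz zx.
by rewrite mul0r.
Qed.

Lemma valuation_lopen x y : 0 <= x -> x <= y -> y <= 1 ->
  g `]x, y] = g `[x, y].
Proof.
move=> x0 xy y1; have xx : 0 <= x <= 1 by rewrite x0 (le_trans xy).
have suby : cake_itv `]x, y]%R by rewrite /= x0 xy.
have subx : cake_itv `[x, x]%R by rewrite /= lexx.
have -> : `[x, y] = `[x, x] `|` `]x, y].
  apply/seteqP; split=> z /=; rewrite !in_itv /=.
    move=> /andP[xz ->]; rewrite andbT.
    by case: (ltP x z) => zx; [right|left]; rewrite // xz.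
  case=> [/andP[-> zx]|/andP[/ltW -> ->] //].
  by rewrite (le_trans zx).
rewrite (valuation_add Hg) ?valuation_pt ?add0r //; last first.
- apply/seteqP; split=> z //= []; rewrite !in_itv /= => /andP[_ zx] /andP[xz _].
  by rewrite ltNge zx in xz.
- exact: cake_itv_piece suby.
- exact: cake_itv_piece.
Qed.

Lemma valuation_itv b x y : 0 <= x -> x <= y -> y <= 1 ->
  g [set` Interval (BSide b x) (BRight y)] = g `[x, y].
Proof. by case: b => // *; rewrite valuation_lopen. Qed.

Lemma valuation_split x y z : 0 <= x -> x <= y -> y <= z -> z <= 1 ->
  g `[x, z] = g `[x, y] + g `[y, z].
Proof.
move=> x0 xy yz z1.
have y0 := le_trans x0 xy; have y1 := le_trans yz z1.
rewrite -(valuation_lopen y0 yz z1).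
have -> : `[x, z] = `[x, y] `|` `]y, z].
  apply/seteqP; split=> t /=.
    have := @mem_itv_split true x y z t xy yz => E tz; move: E; rewrite tz.
    by case: (t \in `[x, y]%R); [left|case: (t \in `]y, z]%R) => //; right].
  have := @mem_itv_split true x y z t xy yz.
  by do 3!case: (t \in _) => //=; move=> _ [].
apply: (valuation_add Hg).
- by apply: cake_itv_piece; rewrite /= x0 xy y1.
- by apply: cake_itv_piece; rewrite /= y0 yz z1.
apply/seteqP; split=> t //= []; rewrite !in_itv /= => /andP[_ ty] /andP[yt _].
by rewrite ltNge ty in yt.
Qed.

Lemma valuation_itv_ge0 x y : 0 <= x -> x <= y -> y <= 1 -> 0 <= g `[x, y].
Proof.
by move=> x0 xy y1; apply/(valuation_ge0 Hg)/cake_itv_piece; rewrite /= x0 xy.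
Qed.

Lemma valuation_mono x y z : 0 <= x -> x <= y -> y <= z -> z <= 1 ->
  g `[x, y] <= g `[x, z].
Proof.
move=> x0 xy yz z1; rewrite (valuation_split x0 xy yz z1) lerDl.
by rewrite valuation_itv_ge0 // (le_trans x0).
Qed.

End Valuation.
End Pieces.

(** * Specifications of cutting, evaluating and trimming *)

Section QuerySpecs.
Variables (R : realType) (V : finType) (f : V -> set R -> R).
Hypothesis Hf : forall v, is_valuation (f v).
Local Open Scope ring_scope.
Local Open Scope classical_set_scope.

(** The value right of [x] is kept equal to [alpha] times the number of pieces still to be made. The
    last piece is what remains and costs no query, hence [k] cuts for [k.+1] pieces. *)
Lemma cut_equal_spec v alpha k b x :
  0 <= alpha -> 0 <= x <= 1 -> f v `[x, 1] = k.+1%:R * alpha ->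
  spec f (cut_equal v alpha k (BSide b x)) (fun ps q =>
    [/\ all (@cake_itv R) ps, size ps = k.+1,
        forall p, p \in ps -> f v [set` p] = alpha, q = k
      & forall z, (\sum_(p <- ps) (z \in p))%N =
                  (z \in Interval (BSide b x) (BRight 1))]).
Proof.
move=> alpha0; elim: k b x => [|k IH] b x /andP[x0 x1] fx1 /=.
  apply: spec_ret; split=> //=; first by rewrite x0 x1 lexx.
  - move=> p; rewrite inE => /eqP ->.
    by rewrite (valuation_itv (Hf v)) // fx1 mul1r.
  - by move=> z; rewrite big_seq1.
apply: spec_cut.
  (* What remains is worth [k.+2] times [alpha], so this fraction of it is exactly [alpha]. *)
  have := @valuation_divisible _ _ (Hf v) x 1 (k.+2%:R^-1) x0 x1 (lexx _).
  rewrite invr_ge0 ler0n invf_le1 ?ltr0n // ler1n => /(_ isT) [z /andP[xz z1]].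
  rewrite fx1 mulKf ?pnatr_eq0 // => fz.
  by exists z; split.
move=> y [_ xy y1 fxy].
have y0 := le_trans x0 xy.
apply: spec_bind.
  apply: IH; first by rewrite y0.
  have := valuation_split (Hf v) x0 xy y1 (lexx 1).
  rewrite fx1 fxy -natr1 mulrDl mul1r addrC => /addrI; exact.
move=> ps q [gps sps fps -> mps]; apply: spec_ret; split=> //=.
- by rewrite x0 xy y1.
- by rewrite sps.
- move=> p; rewrite inE => /predU1P[->|/fps //].
  by rewrite (valuation_itv (Hf v)).
- by rewrite addn0.
- by move=> z; rewrite big_cons mps mem_itv_split.
Qed.

Definition evaluated (v : V) (ps : seq (interval R)) :=
  [seq (p, f v [set` p]) | p <- ps].

Lemma eval_all_spec v ps : all (@cake_itv R) ps ->
  spec f (eval_all v ps) (fun vs q => vs = evaluated v ps /\ q = size ps).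
Proof.
elim: ps => [_|p ps IH /andP[/cake_itvP [b [x [y [-> x0 xy y1]]]] gps]] /=.
  exact: spec_ret.
apply: spec_eval => //; apply: (spec_bind (IH gps)) => _ _ [-> ->].
apply: spec_ret; split; last by rewrite addn0.
by rewrite /evaluated /= (valuation_itv (Hf v) b).
Qed.

(** Only the right end moves, and only to the left, so the piece shrinks for every valuation and not
    just for that of [v]. A piece already worth [alpha] costs no query, which the exact count
    records. *)
Lemma trim_spec v alpha p : cake_itv p -> 0 <= alpha <= f v [set` p] ->
  spec f (let: Interval lb rb := p in
          if f v [set` p] == alpha then Ret p
          else y <-- Cut v (endpoint lb) alpha Ret ;;
               Ret (Interval lb (BRight y)))
   (fun p' q =>
     [/\ cake_itv p', f v [set` p'] = alpha,
         forall g, is_valuation g -> g [set` p'] <= g [set` p],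
         is_piece ([set` p] `\` [set` p']) /\ q = (f v [set` p] != alpha)
       & forall z, ((z \in p') + (z \in [set` p] `\` [set` p']))%N = (z \in p)]).
Proof.
move=> gp; have [b [x [y [-> x0 xy y1]]]] := cake_itvP gp.
move=> /andP[alpha0 le_alpha].
have [E|NE] := eqVneq (f v [set` _]) alpha.
  apply: spec_ret; split=> //; rewrite ?setDv.
  - by rewrite /= x0 xy y1.
  - by split=> //; exact: is_piece0.
  - by move=> z; rewrite in_set0 addn0.
have lt_alpha : alpha < f v `[x, y].
  by rewrite -(valuation_itv (Hf v) b x0 xy y1) lt_neqAle eq_sym NE.
have a_gt0 := le_lt_trans alpha0 lt_alpha.
apply: spec_cut.
  have := @valuation_divisible _ _ (Hf v) x y (alpha / f v `[x, y]) x0 xy y1.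
  rewrite (divr_ge0 alpha0 (ltW a_gt0)) ler_pdivrMr // mul1r (ltW lt_alpha).
  move=> /(_ isT) [z /andP[xz zy]].
  rewrite mulfVK ?gt_eqF // => fz.
  by exists z; split=> //; exact: le_trans y1.
move=> t [/= _ xt t1 ft]; apply: spec_ret.
(* A valid answer to a cut query could lie beyond the piece; here it cannot, because by monotonicity
   [alpha] would be at least the value of the whole piece. *)
have ty : t <= y.
  rewrite leNgt; apply/negP => /ltW yt.
  by have := valuation_mono (Hf v) x0 xy yt t1; rewrite ft leNgt lt_alpha.
have t0 := le_trans x0 xt.
have D : [set` Interval (BSide b x) (BRight y)] `\`
         [set` Interval (BSide b x) (BRight t)] = `]t, y].
  apply/seteqP; split=> z /=.
    case=> zy /negP/negPf zt; move: (mem_itv_split b z xt ty); rewrite zy zt.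
    by case: (z \in _).
  move=> zt; have := mem_itv_split b z xt ty; rewrite zt.
  by do 2!case: (z \in _).
rewrite D; split=> //.
- by rewrite /= x0 xt t1.
- by rewrite (valuation_itv (Hf v)).
- move=> g Hg; rewrite !(valuation_itv Hg) //.
  exact: valuation_mono.
- split=> //; apply: cake_itv_piece; by rewrite /= t0 ty y1.
- move=> z; rewrite -(mem_itv_split b z xt ty); congr (_ + nat_of_bool _)%N.
  by apply/idP/idP; rewrite inE.
Qed.

(** The mass identity assumes that at most one piece contains [z]: the parts cut off are collected
    in a union, whose indicator is the sum of theirs only when they do not overlap at [z]. *)
Lemma trim_all_spec v alpha ps : all (@cake_itv R) ps -> 0 <= alpha ->
  (forall p, p \in ps -> alpha <= f v [set` p]) ->
  spec f (trim_all v alpha (evaluated v ps)) (fun t q =>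
    [/\ [/\ all (@cake_itv R) t.1, size t.1 = size ps & is_piece t.2],
        forall p, p \in t.1 -> f v [set` p] = alpha,
        forall p', p' \in t.1 -> exists2 p, p \in ps &
          forall g, is_valuation g -> g [set` p'] <= g [set` p],
        q = count (fun p => f v [set` p] != alpha) ps
      & forall z, (\sum_(p <- ps) (z \in p) <= 1)%N ->
          ((\sum_(p <- t.1) (z \in p)) + (z \in t.2))%N =
          (\sum_(p <- ps) (z \in p))%N]).
Proof.
move=> + alpha0; elim: ps => [_ _|p ps IH /andP[gp gps] le_alpha] /=.
  apply: spec_ret; split=> //; first by split=> //; exact: is_piece0.
  by move=> z; rewrite in_set0 !big_nil.
have alphap : 0 <= alpha <= f v [set` p].
  by rewrite alpha0 le_alpha ?mem_head.
move: (trim_spec gp alphap).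
case: p gp le_alpha alphap => lb rb gp le_alpha alphap sp.
apply: (spec_bind sp) => p' _ [gp' fp' subp [Dp ->] mp].
apply: spec_bind.
  by apply: IH => // p pps; apply: le_alpha; rewrite inE pps orbT.
move=> [t1 t2] q /= [[gt st pt] ft subt -> mt]; apply: spec_ret; split=> /=.
- by split; [rewrite gp'|rewrite st|exact: is_pieceU].
- by move=> p; rewrite inE => /predU1P[->|/ft].
- move=> p; rewrite inE => /predU1P[->|/subt [p2 p2ps le]].
    by exists (Interval lb rb) => //; rewrite mem_head.
  by exists p2 => //; rewrite inE p2ps orbT.
- by rewrite addn0.
- move=> z; rewrite !big_cons in_setU -mp => le1.
  have := mt z; move: le1.
  case: (z \in p'); case: (z \in _ `\` _); case: (z \in t2); lia.
Qed.

End QuerySpecs.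

(** * The invariant of the protocol and its preservation *)

Section TreeCoreFacts.
Variables (R : realType) (V : finType) (e : rel V) (r : V).
Variable f : V -> set R -> R.
Hypotheses (He : is_tree e) (Hf : forall v, is_valuation (f v)).
Local Open Scope ring_scope.
Local Open Scope classical_set_scope.

Lemma ex_least_valued (vs : seq (interval R * R)) : vs != [::] ->
  exists c, least_valued vs c.
Proof.
elim: vs => // a [_ _|b vs /(_ isT) [c [cvs cmin]] _].
  by exists a; split=> [|d]; rewrite inE // => /eqP ->.
have [ac|/ltW ca] := leP a.2 c.2; [exists a|exists c]; split.
- by rewrite mem_head.
- by move=> d; rewrite inE => /predU1P[->//|/cmin]; exact: le_trans.
- by rewrite inE cvs orbT.
- by move=> d; rewrite inE => /predU1P[->//|/cmin].
Qed.

Lemma ex_most_valued m (vs : seq (interval R * R)) : (m <= size vs)%N ->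
  exists c, most_valued m vs c.
Proof.
move=> le_m; pose ge2 := [rel a b : interval R * R | b.2 <= a.2].
have ge2_total : total ge2 by move=> a b; exact: le_total.
have ge2_trans : transitive ge2 by move=> b a c /= ba cb; exact: le_trans cb ba.
exists (take m (sort ge2 vs), drop m (sort ge2 vs)); split=> /=.
- by rewrite cat_take_drop perm_sort.
- by rewrite size_takel // size_sort.
(* Pairwise sortedness in decreasing order compares every piece taken with every piece left. *)
have := sort_sorted ge2_total vs.
rewrite (sorted_pairwise ge2_trans) -{1}(cat_take_drop m (sort ge2 vs)).
by rewrite pairwise_cat => /and3P[/allrelP H _ _] t s /H; apply.
Qed.

(* Twice the number of queries charged to a subtree with [m] vertices: the
   path rooted at an end attains it, by the recurrence c(m) = c(m-1) + 3m - 1. *)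
Definition charge (m : nat) : nat := 3 * m ^ 2 + m - 2.

(** The pieces that remain at the end are among those each child declined when choosing, which gives
    the comparison with [w.1]. The cost bound leaves room, within the charge of the parent's
    subtree, for her own evaluations and cuts. *)
Lemma serve_spec us ps (h : V -> seq (interval R)) :
  uniq us -> all (@cake_itv R) ps ->
  size ps = (\sum_(u <- us) #|subtree e r u|).+1 ->
  spec f (serve e r us ps h) (fun w q =>
    [/\ [/\ size w.1 = 1%N,
            perm_eq (w.1 ++ flatten [seq w.2 u | u <- us]) ps
          & forall x, x \notin us -> w.2 x = h x],
        forall u, u \in us -> size (w.2 u) = #|subtree e r u|,
        forall u p s, u \in us -> p \in w.2 u -> s \in w.1 ->
          f u [set` s] <= f u [set` p]
      & (2 * q + \sum_(u <- us) charge #|subtree e r u| + 3 * size ps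
          <= 3 * size ps ^ 2)%N]).
Proof.
elim: us ps h => [|u us IH] ps h /=.
  move=> _ _ sps; apply: spec_ret; split=> //.
    by split=> //; rewrite ?cats0 // sps big_nil.
  by rewrite big_nil sps big_nil.
move=> /andP[uNus uus] cps; rewrite big_cons => sps.
apply: (spec_bind (eval_all_spec Hf u cps)) => _ _ [-> ->].
apply: spec_choose => [|[c1 c2] [/= cperm sc1 cle]].
  by apply: ex_most_valued; rewrite size_map sps; lia.
have ps_perm : perm_eq (unzip1 c1 ++ unzip1 c2) ps.
  rewrite -map_cat; have -> : ps = unzip1 (evaluated f u ps).
    by rewrite /unzip1 -map_comp map_id.
  exact: perm_map.
have cval d : d \in c1 ++ c2 -> d.2 = f u [set` d.1].
  by rewrite (perm_mem cperm) => /mapP [p _ ->].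
have sc2 : size c2 = (\sum_(u <- us) #|subtree e r u|).+1.
  have := perm_size ps_perm; rewrite size_cat !size_map sps sc1.
  by rewrite -addnS => /addnI.
have cps2 : all (@cake_itv R) (unzip1 c2).
  by move: cps; rewrite -(perm_all _ ps_perm) all_cat => /andP[].
apply: (spec_weaken (IH _ _ uus cps2 _)); first by rewrite size_map.
move=> [w1 w2] q /= [[sw1 wperm wh] sw2 wle cost].
have w2u : w2 u = unzip1 c1 by rewrite wh //= eqxx.
split.
- split=> //.
    rewrite w2u perm_catCA; apply: perm_trans ps_perm.
    by rewrite perm_cat2l.
  move=> x; rewrite inE negb_or => /andP[/negPf xu xus].
  by rewrite wh //= xu.
- by move=> x; rewrite inE => /predU1P[->|/sw2 //]; rewrite w2u size_map.
- move=> x p s; rewrite inE => /predU1P[->|xus] pin sin; last exact: wle pin sin.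
  have : s \in unzip1 c2 by rewrite -(perm_mem wperm) mem_cat sin.
  move: pin; rewrite w2u => /mapP [d dc1 ->] /mapP [d' dc2 ->].
  by rewrite -!cval ?mem_cat ?dc1 ?dc2 ?orbT //; exact: cle.
- move: cost; rewrite big_cons size_map sps sc2.
  (* Since [a >= 1], the truncated subtraction in [charge] is exact. With [s] pieces left after [u]
     has chosen, the step reduces to [(6 a - 2)(s - 1) >= 0]. *)
  have := card_subtree_gt0 r He u; rewrite /charge.
  move: (\sum_(j <- us) _)%N (\sum_(j <- us) #|_|)%N #|_| => S M a a0.
  nia.
Qed.

(** [D] contains the processed agents. Their final pieces stay in [held], so [inv_mass] counts
    allocated and pending pieces together. The value bounds range over all pieces held, since any of
    them may become the one that is kept or be passed on to a descendant. *)
Record invariant (D queue : seq V) (st : state R V) : Prop := Invariant {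
  inv_cover : forall w,
    ((w \in D) + \sum_(u <- queue) (w \in subtree e r u))%N = 1%N;
  inv_cake : forall w, all (@cake_itv R) (held st w);
  inv_mass : forall x : R,
    (\sum_w \sum_(p <- held st w) (x \in p) + (x \in residue st))%N =
    (x \in `[0, 1]%R);
  inv_residue : is_piece (residue st);
  inv_size : forall u, u \in queue -> size (held st u) = #|subtree e r u|;
  inv_unreached : forall w, w \notin D -> w \notin queue -> held st w = [::];
  inv_alloc : forall v, v \in D ->
    exists2 p, held st v = [:: p] & alloc st v = [set` p];
  inv_descendant : forall v w p, v \in D -> w \in subtree e r v ->
    p \in held st w -> f v [set` p] <= f v (alloc st v);
  inv_child : forall v u p, v \in D -> children e r v u ->
    p \in held st u -> f u (alloc st v) <= f u [set` p];
  inv_root : forall p, p \in held st r -> f r [set` p] = #|V|%:R^-1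
}.

(** The subtree of [v] already accounts for the single unit in [inv_cover], and a queued vertex
    would contribute a second one through its own subtree. *)
Lemma queue_head_subtree D v queue st w :
  invariant D (v :: queue) st -> w \in subtree e r v ->
  w \notin D /\ w \notin queue.
Proof.
move=> inv wv; have := inv_cover inv w; rewrite big_cons wv.
move=> cover; split; apply/negP => wq; move: cover; rewrite ?wq //.
by rewrite (big_rem w) //= (subtree_refl r He); case: (w \in D).
Qed.

(** At a given point, [S] and [T] count the pieces of [v] before and after trimming, [M] the pieces
    of agents outside [v] and her children, [b] the old residue and [t] the part newly cut off. As
    the total is at most 1, the disjunction acts as a sum. *)
Lemma trimmed_mass (S T M : nat) (c b t : bool) :
  (S <= 1 -> T + t = S)%N -> (S + M + b = c)%N -> (T + M + (b || t) = c)%N.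
Proof. by case: c b t => [] [] []; lia. Qed.

Lemma agent_step_spec D v queue st us : invariant D (v :: queue) st ->
  perm_eq us (enum (children e r v)) ->
  spec f (agent_step e r v st) (fun st' q =>
    invariant (v :: D) (queue ++ us) st' /\
    (2 * q + \sum_(u <- us) charge #|subtree e r u|
      <= charge #|subtree e r v|)%N).
Proof.
move=> inv us_perm; rewrite /agent_step.
have cv := inv_cake inv v.
have sv : size (held st v) = #|subtree e r v|.
  by apply: (inv_size inv); rewrite mem_head.
apply: (spec_bind (eval_all_spec Hf v cv)) => _ _ [-> ->].
apply: spec_choose => [|c [cin cmin]] /=.
  apply: ex_least_valued; rewrite -size_eq0 size_map sv.
  by rewrite -lt0n (card_subtree_gt0 r He).
case/mapP: cin cmin => p0 p0in -> {c} /= cmin.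
set alpha := f v [set` p0].
have alpha0 : 0 <= alpha.
  by apply/(valuation_ge0 (Hf v))/cake_itv_piece/(allP cv).
have alpha_min p : p \in held st v -> alpha <= f v [set` p].
  by move=> pin; apply: (cmin (p, f v [set` p])); apply/mapP; exists p.
apply: (spec_bind (trim_all_spec Hf cv alpha0 alpha_min)).
move=> [t1 t2] _ /= [[ct st1 pt2] ft subt -> mt].
apply: spec_choose => [|us' us'_perm]; first by exists (enum (children e r v)).
have uus' : uniq us' by rewrite (perm_uniq us'_perm) enum_uniq.
have us'E u : (u \in us') = children e r v u.
  by rewrite (perm_mem us'_perm) mem_enum.
have usE u : (u \in us) = children e r v u.
  by rewrite (perm_mem us_perm) mem_enum.
have st1' : size t1 = (\sum_(u <- us') #|subtree e r u|).+1.
  by rewrite st1 sv (card_subtree_rec r He) (big_children _ us'_perm).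
apply: (spec_bind (serve_spec (held st) uus' ct st1')).
move=> [w1 w2] q /= [[sw1 wperm wh] sw2 wle cost].
apply: spec_choose => [|p w1E].
  by case: w1 sw1 {wperm wle} => [|p []] //; exists p.
rewrite w1E in wperm wle; apply: spec_ret; split; last first.
  (* The least valued piece [p0] is worth [alpha] and is not cut, so at least one cut is saved. *)
  have lt_count :
      (count (fun p => f v [set` p] != alpha) (held st v) < #|subtree e r v|)%N.
    rewrite -sv -(count_predC (fun p => f v [set` p] != alpha) (held st v)).
    rewrite -addn1 leq_add2l -has_count; apply/hasP; exists p0 => //=.
    by rewrite negbK.
  move: cost lt_count; rewrite (big_children _ us'_perm) (big_children _ us_perm).
  rewrite st1 sv /charge.
  move: (\sum_(u | _) _)%N (count _ _) #|_| => S k m; nia.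
have child_sub u : children e r v u -> u \in subtree e r v by case/andP.
have vNus' : v \notin us'.
  by rewrite us'E; apply/negP => /(child_neq He); rewrite eqxx.
have [vND vNq] := queue_head_subtree inv (subtree_refl r He v).
have pt1 : p \in t1 by rewrite -(perm_mem wperm) mem_head.
set held' := [eta w2 with v |-> [:: p]].
have held'v : held' v = [:: p] by rewrite /held' /= eqxx.
have held'_child u : children e r v u -> held' u = w2 u.
  by move=> /(child_neq He)/negPf vu; rewrite /held' /= vu.
have held'_other u : u != v -> ~~ children e r v u -> held' u = held st u.
  by move=> /negPf uv vu; rewrite /held' /= uv wh // us'E.
(* This dichotomy drives the proof: a piece is either a trimmed one, now with [v] or one of her
   children, or it has not changed hands. *)
have held'P w p' : p' \in held' w ->
    (p' \in t1 /\ (w = v \/ children e r v w)) \/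
    [/\ p' \in held st w, w != v & ~~ children e r v w].
  have [->|wv] := eqVneq w v.
    by rewrite held'v inE => /eqP ->; left; split=> //; left.
  have [cw|cw] := boolP (children e r v w).
    rewrite held'_child // => p'in; left; split; last by right.
    rewrite -(perm_mem wperm) inE; apply/orP; right.
    by apply/flattenP; exists (w2 w) => //; apply: map_f; rewrite us'E.
  by rewrite held'_other //; right.
(* To [v], a trimmed piece is worth as much as her old piece [p0]. Hence both the lower bound of
   [inv_child] and the equality of [inv_root] carry over when [v] is the judge. *)
have ft_old p' : p' \in t1 ->
    exists2 p2, p2 \in held st v & f v [set` p'] = f v [set` p2].
  by move=> /ft ->; exists p0.
have fpv : f v [set` p] = alpha by exact: ft.
clearbody held'; split=> /=.
- move=> w; rewrite -(inv_cover inv w) big_cons (subtree_rec r He).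
  rewrite big_cat /= (big_children _ us_perm).
  have -> : (w \in v :: D : nat) = ((w == v) + (w \in D))%N.
    by rewrite inE; have [->|//] := eqVneq w v; rewrite (negPf vND).
  rewrite -!addnA addnCA; congr (_ + (_ + _))%N; exact: addnC.
- move=> w; apply/allP => p' /held'P [[p't _]|[p'in _ _]].
    exact: (allP ct).
  exact: (allP (inv_cake inv w)).
- move=> x; have := inv_mass inv x; have := mt x.
  have split_mass (h : V -> seq (interval R)) :
      (\sum_w \sum_(p <- h w) (x \in p) =
       \sum_(w <- v :: us') \sum_(p <- h w) (x \in p) +
       \sum_(w | w \notin v :: us') \sum_(p <- h w) (x \in p))%N.
    by rewrite (bigID (mem (v :: us'))) /= -big_uniq //= vNus'.
  rewrite !split_mass.
  (* The children were not reached before this step, so only [v] contributes. *)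
  have -> : (\sum_(w <- v :: us') \sum_(p <- held st w) (x \in p) =
             \sum_(p <- held st v) (x \in p))%N.
    rewrite big_cons [X in (_ + X)%N]big_seq [X in (_ + X)%N]big1 ?addn0 // => u.
    rewrite us'E => cu; have [uD uq] := queue_head_subtree inv (child_sub _ cu).
    by rewrite (inv_unreached inv) ?big_nil // inE negb_or uq (child_neq He cu).
  have -> : (\sum_(w <- v :: us') \sum_(p <- held' w) (x \in p) =
             \sum_(p <- t1) (x \in p))%N.
    rewrite -(perm_big _ wperm) big_cons held'v big_seq1 big_cons big_flatten.
    rewrite /= big_map; congr addn; apply: eq_big_seq => u.
    by rewrite us'E => /held'_child ->.
  have -> : (\sum_(w | w \notin v :: us') \sum_(p <- held' w) (x \in p) =
             \sum_(w | w \notin v :: us') \sum_(p <- held st w) (x \in p))%N.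
    apply: eq_bigr => w; rewrite inE negb_or us'E => /andP[wv cw].
    by rewrite held'_other.
  by rewrite in_setU; exact: trimmed_mass.
- by apply: is_pieceU pt2; exact: inv_residue inv.
- move=> u; rewrite mem_cat usE => /orP[uq|cu]; last first.
    by rewrite held'_child // sw2 // us'E.
  rewrite held'_other; first by apply: (inv_size inv); rewrite inE uq orbT.
    by apply: contraNneq vNq => <-.
  apply/negP => /child_sub uv.
  by have [_] := queue_head_subtree inv uv; rewrite uq.
- move=> w; rewrite inE mem_cat !negb_or usE => /andP[wv wD] /andP[wq cw].
  rewrite held'_other //; apply: (inv_unreached inv) => //.
  by rewrite inE negb_or wv.
- move=> w; rewrite inE; have [->|wv] /= := eqVneq w v.
    by move=> _; exists p.
  move=> wD; rewrite held'_other //; first exact: inv_alloc inv _ wD.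
  apply/negP => /child_sub uv.
  by have [] := queue_head_subtree inv uv; rewrite wD.
- move=> x w p'; rewrite inE; have [->|xv] /= := eqVneq x v.
    move=> _ wv /held'P [[/ft -> _]|[]]; first by rewrite fpv.
    move=> + wNv _; have [wD wq] := queue_head_subtree inv wv.
    by rewrite (inv_unreached inv) // inE negb_or wNv.
  move=> xD wx /held'P [[p't cw]|[p'in _ _]]; last exact: (inv_descendant inv) p'in.
  (* A new holder below [x] is [v] or a child of [v]; in the latter case the child is not [x], which
     is processed already, so [v] lies below [x] too. The piece is then part of one that [v] held,
     to which the old bound applies. *)
  have vx : v \in subtree e r x.
    case: cw wx => [->//|cw /(subtree_child He cw) [xw|//]].
    have [] := queue_head_subtree inv (child_sub _ cw).
    by rewrite -xw xD.
  have [p2 p2in /(_ _ (Hf x)) le2] := subt _ p't.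
  exact: le_trans le2 (inv_descendant inv xD vx p2in).
- move=> x u p'; rewrite inE; have [->|xv] /= := eqVneq x v.
    move=> _ cu; rewrite held'_child // => p'in.
    by apply: wle p'in _; rewrite ?us'E // inE.
  move=> xD cu /held'P [[p't cw]|[p'in _ _]]; last exact: (inv_child inv) p'in.
  (* A child of [v] has no other parent [x], so the holder [u] is [v] herself. *)
  case: cw => [uv|cu']; last first.
    by have := parent_unique He cu cu' => xv'; rewrite xv' eqxx in xv.
  have [p2 p2in] := ft_old _ p't; rewrite uv => ->.
  by apply: (inv_child inv) p2in => //; rewrite -uv.
- move=> p' /held'P [[p't cw]|[p'in _ _]]; last exact: (inv_root inv).
  case: cw => [rv|cr]; last by have := root_not_child r He v; rewrite cr.
  have [p2 p2in] := ft_old _ p't; rewrite -rv => ->.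
  by apply: (inv_root inv); rewrite rv.
Qed.

(** The charges of the queue serve as a potential: the charge of [v] pays for her step and for the
    charges of the children that enter the queue. *)
Lemma agent_steps_spec queue s : bfs_from e r queue s ->
  forall D st, invariant D queue st ->
  spec f (agent_steps e r s st) (fun st' q =>
    (exists D', invariant D' [::] st') /\
    (2 * q <= \sum_(u <- queue) charge #|subtree e r u|)%N).
Proof.
elim=> [|v {}queue us {}s us_perm _ IH] D st inv /=.
  by apply: spec_ret; split; [exists D|].
apply: (spec_bind (agent_step_spec inv us_perm)) => st' q [inv' le1].
apply: (spec_weaken (IH _ _ inv')) => st'' q' [ex le2]; split=> //.
by move: le1 le2; rewrite big_cons big_cat /=; lia.
Qed.

Lemma TreeCore_spec : spec f (TreeCore R e r) (fun AR q =>
  (q <= 2 * #|V| ^ 2)%N /\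
  exists D st, [/\ invariant D [::] st, AR.1 = alloc st & AR.2 = residue st]).
Proof.
rewrite /TreeCore; have V0 : (0 < #|V|)%N by apply/card_gt0P; exists r.
apply: spec_bind.
  apply: (cut_equal_spec Hf); first by rewrite invr_ge0 ler0n.
    by rewrite lexx ler01.
  by rewrite prednK // mulfV ?pnatr_eq0 -?lt0n // (valuation_cake (Hf r)).
move=> ps _ [cps sps fps -> mps].
apply: spec_choose => [|s bfs_s] /=; first exact: ex_bfs_from.
apply: spec_bind.
  apply: (agent_steps_spec bfs_s (D := [::])); split=> /=.
  - by move=> w; rewrite big_seq1 subtree_root.
  - by move=> w; case: eqP.
  - move=> x; rewrite in_set0 addn0 (bigD1 r) //= eqxx mps.
    by rewrite big1 ?addn0 // => w /negPf ->; rewrite big_nil.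
  - exact: is_piece0.
  - move=> u; rewrite inE => /eqP ->; rewrite eqxx sps prednK //.
    by rewrite (card_subtree_root r He).
  - by move=> w _; rewrite inE => /negPf ->.
  - by [].
  - by [].
  - by [].
  - by move=> p; rewrite eqxx; exact: fps.
move=> st q [[D inv] le_q]; apply: spec_ret; split; last by exists D, st.
(* With [n] agents, the [n - 1] initial cuts bring twice the count to at most [3 n^2 + 3 n - 4],
   which is below [4 n^2] because [n^2 - 3 n + 4 > 0]. *)
move: le_q V0; rewrite big_seq1 (card_subtree_root r He) /charge.
by case: #|V| => [|[|m]]; nia.
Qed.

Lemma invariant_visited D st v : invariant D [::] st -> v \in D.
Proof. by move=> /inv_cover /(_ v); rewrite big_nil; case: (v \in D). Qed.

(** With the queue empty, every agent holds exactly her allocated piece. That the sum in [inv_mass]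
    is at most 1 gives disjointness, and that it equals 1 on the cake gives covering. *)
Lemma invariant_partial_allocation D st : invariant D [::] st ->
  partial_allocation (alloc st) (residue st).
Proof.
move=> inv.
have allocP v := inv_alloc inv (invariant_visited v inv).
have mem1 v x : alloc st v x -> (\sum_(p <- held st v) (x \in p))%N = 1%N.
  by have [p -> ->] /= := allocP v => xp; rewrite big_seq1 xp.
have mem0 v x : ~ alloc st v x -> (\sum_(p <- held st v) (x \in p))%N = 0%N.
  by have [p -> ->] /= := allocP v => /negP/negPf xp; rewrite big_seq1 xp.
split.
- move=> v; have [p hp ->] := allocP v; apply: cake_itv_piece.
  by have := inv_cake inv v; rewrite hp /= andbT.
- exact: inv_residue inv.
- move=> u v uv; apply/seteqP; split=> x //= [xu xv].
  have := leq_b1 (x \in `[0, 1]%R); rewrite -(inv_mass inv x) (bigD1 u) //=.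
  by rewrite (bigD1 v) 1?eq_sym //= !mem1.
- move=> v; apply/seteqP; split=> x //= [xv xR].
  have := leq_b1 (x \in `[0, 1]%R); rewrite -(inv_mass inv x) (bigD1 v) //=.
  by rewrite mem1 // mem_set // addn1.
apply/seteqP; split=> x /=.
  have := inv_mass inv x => E [[v _ xv]|xR]; move: E.
    by rewrite (bigD1 v) //= mem1 //; case: (x \in `[0, 1]%R).
  by rewrite mem_set // addn1; case: (x \in `[0, 1]%R).
move=> x01; have := inv_mass inv x; rewrite x01 => E.
have [xR|xR] := pselect (residue st x); first by right.
left; apply: contrapT => xA; move: E; rewrite memNset // big1 // => v _.
by apply: mem0 => xv; apply: xA; exists v.
Qed.

End TreeCoreFacts.

(** * Fairness and query bound read off from the final invariant *)

Local Open Scope ring_scope.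

Theorem theorem4 (R : realType) (V : finType) (n : nat) (e : rel V) (r : V)
    (f : V -> set R -> R)
    (Hn : #|V| = n) (He : is_tree e) (Hf : forall v, is_valuation (f v)) :
  never_stuck f (TreeCore R e r) /\
  forall (A : V -> set R) (Res : set R) (q : nat),
    run f (TreeCore R e r) (A, Res) q ->
    [/\ partial_allocation A Res,
        locally_envy_free e f A,
        (q <= 2 * n ^ 2)%N,
        (forall v w, w \in subtree e r v -> f v (A w) <= f v (A v))
      & f r (A r) = n%:R^-1].
Proof.
have [ns rn] := TreeCore_spec r He Hf; split=> // A Res q.
move=> /rn [le_q [D [st [inv /= -> ->]]]]; rewrite -Hn.
have visited v := invariant_visited v inv.
have heldP v : exists2 p : interval R,
    p \in held st v & alloc st v = [set` p]%classic.
  by have [p hp ap] := inv_alloc inv (visited v); exists p; rewrite // hp mem_head.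
have desc v w : w \in subtree e r v -> f v (alloc st w) <= f v (alloc st v).
  move=> wv; have [p pin ->] := heldP w.
  exact: (inv_descendant inv (visited v) wv pin).
split=> //.
- exact: invariant_partial_allocation inv.
(* A neighbor is either a child, covered by the bound for descendants, or the parent, covered by
   [inv_child] applied to the piece that [v] keeps. *)
- move=> v u /(edge_children r He) [/andP[_ /desc] //|cv].
  by have [p pin ->] := heldP v; exact: (inv_child inv (visited u) cv pin).
- by have [p pin ->] := heldP r; exact: (inv_root inv pin).
Qed.
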